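(* Let $G$ be a finite simple graph. Then $m(G) = 2^{\beta(G)}$ if and only if $G$ is a bipartite Cameron-Walker graph, i.e. $G$ is bipartite and $\nu(G)=\nu_0(G)$.
   Context: For a finite simple graph $G$, $m(G)$ denotes the number of maximal independent sets of $G$ (a graph with no edges, including the graph with no vertices, has $m(G)=1$). A vertex cover of $G$ is a set $C\subseteq V(G)$ such that every edge has at least one endpoint in $C$; $\beta(G)$ is the minimum size of a vertex cover. A matching is a set of pairwise disjoint edges; $\nu(G)$ is the maximum size of a matching. An induced matching is a matching $M$ such that no two edges of $M$ are joined by an edge of $G$; $\nu_0(G)$ is the maximum size of an induced matching. $G$ is called a Cameron-Walker graph if $\nu(G)=\nu_0(G)$. *)

(* Defs.v *)
From mathcomp Require Import all_boot.

Set Implicit Arguments.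
Unset Strict Implicit.
Unset Printing Implicit Defensive.

(* A finite simple graph is a symmetric irreflexive relation [e] on a finType
   [T]; these two properties are hypotheses of the theorem, not of the
   definitions. *)

Definition edges (T : finType) (e : rel T) : {set {set T}} :=
  [set [set p.1; p.2] | p : T * T & e p.1 p.2].

Definition independent (T : finType) (e : rel T) (S : {set T}) : bool :=
  [forall x in S, forall y in S, ~~ e x y].

Definition num_mis (T : finType) (e : rel T) : nat :=
  #|[set S : {set T} | maxset (independent e) S]|.

Definition vertex_cover (T : finType) (e : rel T) (C : {set T}) : bool :=
  [forall x, forall y, e x y ==> (x \in C) || (y \in C)].

(* The default [set: T] of the arg min is itself always a vertex cover. *)
Definition cover_number (T : finType) (e : rel T) : nat :=
  #|[arg min_(C < [set: T] | vertex_cover e C) #|C|]|.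

Definition matching (T : finType) (e : rel T) (M : {set {set T}}) : bool :=
  (M \subset edges e) && trivIset M.

Definition joined (T : finType) (e : rel T) (A B : {set T}) : bool :=
  [exists x in A, exists y in B, e x y].

Definition induced_matching (T : finType) (e : rel T) (M : {set {set T}}) :
    bool :=
  matching e M &&
  [forall A in M, forall B in M, (A != B) ==> ~~ joined e A B].

Definition matching_number (T : finType) (e : rel T) : nat :=
  \max_(M : {set {set T}} | matching e M) #|M|.

Definition induced_matching_number (T : finType) (e : rel T) : nat :=
  \max_(M : {set {set T}} | induced_matching e M) #|M|.

Definition cameron_walker (T : finType) (e : rel T) : Prop :=
  matching_number e = induced_matching_number e.

Definition bipartite (T : finType) (e : rel T) : Prop :=
  exists A : {set T}, independent e A /\ independent e (~: A).

(* Main.v *)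
Require Import Defs.
From mathcomp Require Import all_boot.

Set Implicit Arguments.
Unset Strict Implicit.
Unset Printing Implicit Defensive.

(** For a vertex cover [C], a maximal independent set [S] is determined by
    [S :&: C], so m(G) <= 2^beta(G).  If equality holds, every subset of a
    minimum cover [C] is such a trace: the trace [C] shows that [C] is
    independent, and the trace [C :\ c] yields a neighbour of [c] that is
    adjacent to no other vertex of [C]; these private neighbours form with [C]
    an induced matching of size beta(G) >= nu(G).

    Conversely, choosing one endpoint in each edge of an induced matching and
    extending to a maximal independent set gives 2^nu_0(G) <= m(G).  It remains
    to see that beta(G) <= nu(G), and König's theorem is not needed: let [M] be
    a maximum matching that is induced.  No edge of [M] has both endpoints
    adjacent to unmatched vertices (this would be an augmenting path, as there
    are no triangles), so taking in each edge of [M] the endpoint that has an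
    unmatched neighbour, if any, yields a vertex cover. *)

Section Graph.

Variables (T : finType) (e : rel T).
Hypotheses (e_sym : symmetric e) (e_irr : irreflexive e).

Implicit Types (A B C S X : {set T}) (M : {set {set T}}).

(** * Edges, covers and matchings *)

Lemma independentP S :
  reflect {in S &, forall x y, ~~ e x y} (independent e S).
Proof.
apply: (iffP forall_inP) => [h x y xS yS|h x xS].
  exact: (forall_inP (h x xS)).
by apply/forall_inP => y yS; apply: h.
Qed.

Lemma vertex_coverP C :
  reflect (forall x y, e x y -> (x \in C) || (y \in C)) (vertex_cover e C).
Proof.
apply: (iffP forallP) => [h x y|h x].
  by move/forallP: (h x) => /(_ y)/implyP.
by apply/forallP => y; apply/implyP/h.
Qed.

Lemma edgeP B :
  reflect (exists x y, e x y /\ B = [set x; y]) (B \in edges e).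
Proof.
apply: (iffP imsetP) => [[[x y]]|[x [y [exy ->]]]].
  by rewrite inE /= => exy ->; exists x, y.
by exists (x, y); rewrite ?inE.
Qed.

Lemma edge_neq x y : e x y -> x != y.
Proof. by apply: contraTneq => ->; rewrite e_irr. Qed.

Lemma edge_pair B x y :
  B \in edges e -> x \in B -> y \in B -> x != y -> e x y /\ B = [set x; y].
Proof.
case/edgeP=> [u [v [euv ->]]]; rewrite !inE.
by case/orP=> /eqP-> /orP[]/eqP->; rewrite ?eqxx // e_sym setUC.
Qed.

Lemma min_cover_exists :
  exists2 C, vertex_cover e C & #|C| = cover_number e.
Proof.
rewrite /cover_number; case: arg_minnP => [|C cC _]; last by exists C.
by apply/vertex_coverP => x y _; rewrite inE.
Qed.

Lemma cover_number_le C : vertex_cover e C -> cover_number e <= #|C|.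
Proof.
rewrite /cover_number; case: arg_minnP => [|D _ minD]; last exact: minD.
by apply/vertex_coverP => x y _; rewrite inE.
Qed.

Lemma induced_matching_exists :
  exists2 M, induced_matching e M & #|M| = induced_matching_number e.
Proof.
have: 0 < #|[pred M | induced_matching e M]|.
  apply/card_gt0P; exists set0; rewrite inE /induced_matching /matching sub0set.
  apply/andP; split; first by apply/trivIsetP => A B; rewrite inE.
  by apply/forall_inP => A; rewrite inE.
by case/(eq_bigmax_cond (fun M => #|M|)) => M iM eqM; exists M.
Qed.

Lemma matching_number_ge M : matching e M -> #|M| <= matching_number e.
Proof. exact: (leq_bigmax_cond (F := fun M => #|M|)). Qed.

Lemma induced_le_matching : induced_matching_number e <= matching_number e.
Proof.
have [M /andP[mM _] <-] := induced_matching_exists.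
exact: matching_number_ge.
Qed.

(** Each edge of [M] has an endpoint in [C] and is the block of that endpoint, so [pblock M] maps
    [C] onto a family containing [M]. *)
Lemma matching_le_cover M C :
  matching e M -> vertex_cover e C -> #|M| <= #|C|.
Proof.
case/andP=> ME tM /vertex_coverP cC.
apply: leq_trans (leq_imset_card (pblock M) C); apply: subset_leq_card.
apply/subsetP => B BM; have /edgeP[x [y [exy defB]]] := subsetP ME B BM.
have pB z : z \in B -> B = pblock M z by move=> zB; rewrite (def_pblock tM BM).
case/orP: (cC x y exy) => zC; apply/imsetP.
  by exists x => //; apply: pB; rewrite defB set21.
by exists y => //; apply: pB; rewrite defB set22.
Qed.

(** * Traces of maximal independent sets on a vertex cover *)

Lemma mis_dominating S x :
  maxset (independent e) S -> x \notin S -> exists2 y, y \in S & e x y.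
Proof.
case/maxsetP => /independentP iS maxS xS; apply/exists_inP.
apply: contraNT xS; rewrite negb_exists_in => /forall_inP nx.
rewrite -(maxS (x |: S)) ?setU11 ?subsetUr //.
apply/independentP => u v; rewrite !inE.
case/predU1P=> [->|uS]; case/predU1P=> [->|vS].
- by rewrite e_irr.
- exact: nx.
- by rewrite e_sym nx.
- exact: iS.
Qed.

(** If [x] lies in [S1] but not in [S2], it has a neighbour [y] in [S2]. Equal traces put [x]
    outside [C], hence [y] in [C] and so in [S1], which is independent. *)
Lemma mis_trace_inj C :
  vertex_cover e C ->
  {in [set S | maxset (independent e) S] &, injective (fun S => S :&: C)}.
Proof.
move/vertex_coverP=> cC S S'; rewrite !inE.
have sub S1 S2 : maxset (independent e) S1 -> maxset (independent e) S2 ->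
    S1 :&: C = S2 :&: C -> S1 \subset S2.
  move=> mS1 mS2 /setP eqC; apply/subsetP => x xS1; apply: contraT => xS2.
  have [y yS2 exy] := mis_dominating mS2 xS2.
  have xC : x \notin C by have := eqC x; rewrite !inE xS1 (negPf xS2) /= => ->.
  have yC : y \in C by have := cC _ _ exy; rewrite (negPf xC).
  have yS1 : y \in S1 by have := eqC y; rewrite !inE yS2 yC !andbT.
  by case/maxsetP: mS1 => /independentP/(_ x y xS1 yS1); rewrite exy.
by move=> mS mS' eqC; apply/eqP; rewrite eqEsubset !sub.
Qed.

Lemma num_mis_le C : vertex_cover e C -> num_mis e <= 2 ^ #|C|.
Proof.
move=> cC; rewrite /num_mis -(card_in_imset (mis_trace_inj cC)) -card_powerset.
by apply/subset_leq_card/subsetP => X /imsetP[S _ ->]; rewrite inE subsetIr.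
Qed.

(** * The equality case: all subsets of the cover are traces *)

Lemma mis_trace_surj C X :
  vertex_cover e C -> num_mis e = 2 ^ #|C| -> X \subset C ->
  exists2 S, maxset (independent e) S & S :&: C = X.
Proof.
move=> cC; rewrite /num_mis -(card_in_imset (mis_trace_inj cC)) -card_powerset.
set I := _ @: _ => eqI sXC.
have /eqP defI : I == powerset C.
  rewrite eqEcard eqI leqnn andbT.
  by apply/subsetP => Y /imsetP[S _ ->]; rewrite inE subsetIr.
have : X \in I by rewrite defI inE.
by case/imsetP=> S; rewrite inE => mS ->; exists S.
Qed.

Lemma full_trace_independent C :
  vertex_cover e C -> num_mis e = 2 ^ #|C| -> independent e C.
Proof.
move=> cC eqm; have [S /maxsetP[/independentP iS _] SC] :=
  mis_trace_surj cC eqm (subxx C).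
apply/independentP => x y; rewrite -SC !inE => /andP[xS _] /andP[yS _].
exact: iS.
Qed.

(** Take [S] with trace [C :\ c]: by maximality [c] has a neighbour in [S], and every other vertex
    of [C] is itself in [S], hence not adjacent to it. *)
Lemma full_trace_private C c :
  vertex_cover e C -> num_mis e = 2 ^ #|C| -> c \in C ->
  exists y, [/\ y \notin C, e c y & {in C, forall d, e d y -> d = c}].
Proof.
move=> cC eqm cinC; have /independentP iC := full_trace_independent cC eqm.
have [S mS SC] := mis_trace_surj cC eqm (subsetDl C [set c]).
have cS : c \notin S.
  by have /setP/(_ c) := SC; rewrite !inE eqxx cinC andbT => ->.
have [y yS ecy] := mis_dominating mS cS; exists y; split => //.
  by apply: contraTN ecy; apply: iC.
move=> d dC edy; apply/eqP; apply: contraTT edy => dc.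
have /setP/(_ d) := SC; rewrite !inE dC dc andbT => dS.
by case/maxsetP: mS => /independentP iS _; apply: iS.
Qed.

Lemma private_neighbours_matching C (f : T -> T) :
  independent e C ->
  {in C, forall c, [/\ f c \notin C, e c (f c)
                     & {in C, forall d, e d (f c) -> d = c}]} ->
  independent e (~: C) ->
  #|C| <= induced_matching_number e.
Proof.
move=> /independentP iC fP /independentP iC'.
have finj : {in C &, injective (fun c => [set c; f c])}.
  move=> c d cC dC /setP/(_ c); rewrite !inE eqxx.
  case: (eqVneq c d) => //= _ /esym/eqP cfd.
  by have [] := fP d dC; rewrite -cfd cC.
rewrite -(card_in_imset finj).
apply: (leq_bigmax_cond (F := fun M => #|M|)); apply/andP; split; last first.
  apply/forall_inP=> _ /imsetP[c cC ->]; apply/forall_inP=> _ /imsetP[d dC ->].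
  have [fcC _ fcP] := fP c cC; have [fdC _ fdP] := fP d dC.
  apply/implyP; apply: contra => /exists_inP[x xc /exists_inP[y yd exy]].
  suff -> : c = d by [].
  (* Independence of [C] and of its complement rules out the edges [c]-[d] and [f c]-[f d]; privacy
     of the neighbours settles the two mixed cases. *)
  move: xc yd exy; rewrite !inE => /orP[]/eqP-> /orP[]/eqP->.
  - by move=> ecd; have := iC c d cC dC; rewrite ecd.
  - exact: fdP.
  - by rewrite e_sym => /fcP->.
  - by move=> eff; have := iC' (f c) (f d); rewrite !inE eff => /(_ fcC fdC).
apply/andP; split.
  apply/subsetP => _ /imsetP[c cC ->]; apply/edgeP.
  by exists c, (f c); split=> //; have [] := fP c cC.
apply/trivIsetP => _ _ /imsetP[c cC ->] /imsetP[d dC ->] neq.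
apply: contraR neq; rewrite -setI_eq0 => /set0Pn[x].
have [fcC ecf fcP] := fP c cC; have [fdC edf fdP] := fP d dC.
suff E : x \in [set c; f c] -> x \in [set d; f d] -> c = d.
  by case/setIP=> xc xd; rewrite (E xc xd).
rewrite !inE => /orP[]/eqP-> /orP[]/eqP E //.
- by rewrite -E cC in fdC.
- by rewrite E dC in fcC.
- by apply: fdP; rewrite // -E.
Qed.

Lemma full_num_mis_cameron_walker :
  num_mis e = 2 ^ cover_number e -> bipartite e /\ cameron_walker e.
Proof.
have [C cC <-] := min_cover_exists => eqm.
have iC := full_trace_independent cC eqm.
have iC' : independent e (~: C).
  apply/independentP => x y; rewrite !inE => xC yC; apply/negP => exy.
  by move/vertex_coverP: cC => /(_ x y exy); rewrite (negPf xC) (negPf yC).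
split; first by exists C.
(* Membership in [C] sits under the existential so that [f] is total; outside [C] any value will
   do. *)
have /fin_all_exists[f fP] : forall c, exists y, c \in C ->
    [/\ y \notin C, e c y & {in C, forall d, e d y -> d = c}].
  move=> c; have [cinC|_] := boolP (c \in C); last by exists c.
  by have [y yP] := full_trace_private cC eqm cinC; exists y.
apply/eqP; rewrite eqn_leq induced_le_matching andbT.
apply: leq_trans (private_neighbours_matching iC fP iC').
by apply/bigmax_leqP => M mM; apply: matching_le_cover.
Qed.

(** * Bipartite graphs: endpoint selections in an induced matching *)

Lemma bipartite_edge A x y :
  independent e A -> independent e (~: A) -> e x y -> (x \in A) = (y \notin A).
Proof.
move=> /independentP iA /independentP iA' exy.
have [xA|xA] := boolP (x \in A); have [yA|yA] := boolP (y \in A) => //.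
  by have := iA x y xA yA; rewrite exy.
by have := iA' x y; rewrite !inE exy => /(_ xA yA).
Qed.

Lemma induced_matching_block M x y :
  induced_matching e M -> x \in cover M -> y \in cover M -> e x y ->
  pblock M x = pblock M y.
Proof.
case/andP=> _ /forall_inP iM xM yM exy.
have xP := pblock_mem xM; have yP := pblock_mem yM.
apply/eqP; apply: contraT => neq.
have /forall_inP/(_ _ yP)/implyP/(_ neq)/exists_inPn/(_ x) := iM _ xP.
rewrite mem_pblock => /(_ xM)/exists_inPn/(_ y).
by rewrite mem_pblock exy => /(_ yM).
Qed.

(* The sets [X \subset M] encode the selections of one endpoint per edge of
   [M]: the endpoint in [A] for the edges of [X], the other one elsewhere. *)
Lemma num_mis_ge A M :
  independent e A -> independent e (~: A) -> induced_matching e M ->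
  2 ^ #|M| <= num_mis e.
Proof.
move=> iA iA' iM; have /andP[/andP[ME tM] _] := iM.
rewrite -card_powerset.
(* [g] decodes a selection from a maximal independent set; it suffices that every [X] is decoded
   from some [S]. *)
pose g S := [set B in M | B :&: A :&: S != set0].
apply: leq_trans (leq_imset_card g _); apply/subset_leq_card/subsetP => X.
rewrite inE => sXM.
pose J := [set v in cover M | (v \in A) == (pblock M v \in X)].
(* Adjacent vertices of [J] would share a block, as [M] is induced, yet lie on opposite sides of the
   bipartition. *)
have iJ : independent e J.
  apply/independentP => u v; rewrite !inE => /andP[uM /eqP uJ] /andP[vM /eqP vJ].
  apply/negP => euv; move: (bipartite_edge iA iA' euv).
  by rewrite uJ vJ (induced_matching_block iM uM vM euv); case: (_ \in X).
have [S mS sJS] := maxset_exists iJ.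
apply/imsetP; exists S; first by rewrite inE.
case/maxsetP: (mS) => /independentP iS _.
apply/setP => B; rewrite inE.
have [BM|BM] := boolP (B \in M); last by apply: contraNF BM; apply: (subsetP sXM).
have [a [b [eab defB aA]]] : exists a b, [/\ e a b, B = [set a; b] & a \in A].
  have /edgeP[x [y [exy defB]]] := subsetP ME B BM.
  have := bipartite_edge iA iA' exy; have [xA _|xA yA] := boolP (x \in A).
    by exists x, y.
  exists y, x; split; [by rewrite e_sym | by rewrite setUC |].
  by rewrite -[y \in A]negbK -yA.
have bA : b \notin A by rewrite -(bipartite_edge iA iA' eab).
have aB : a \in B by rewrite defB set21.
have bB : b \in B by rewrite defB set22.
have inM x : x \in B -> x \in cover M by move=> xB; apply/bigcupP; exists B.
have defP x : x \in B -> pblock M x = B by exact: def_pblock.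
apply/idP/idP => [BX|/set0Pn[x /setIP[/setIP[xB xA] xS]]].
  apply/set0Pn; exists a; rewrite !inE aB aA /=.
  by apply: (subsetP sJS); rewrite inE inM // aA defP // BX.
have xa : x = a.
  by move: xB xA; rewrite defB !inE => /orP[]/eqP-> //; rewrite (negPf bA).
(* If [B] were not in [X], the selected endpoint would be [b], so [S] would contain both ends of
   [B]. *)
apply: contraT => BX.
have bS : b \in S.
  by apply: (subsetP sJS); rewrite inE inM // (negPf bA) defP // (negPf BX).
by have := iS a b; rewrite -{1}xa eab => /(_ xS bS).
Qed.

(** * Augmentation, and a cover built from a maximum matching *)

Lemma matching_add M x y :
  matching e M -> e x y -> x \notin cover M -> y \notin cover M ->
  matching e ([set x; y] |: M) /\ #|[set x; y] |: M| = #|M|.+1.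
Proof.
case/andP=> ME tM exy xM yM.
have dis B : B \in M -> [disjoint [set x; y] & B].
  move=> BM; rewrite -setI_eq0; apply/eqP/setP => z; rewrite !inE.
  apply/negbTE/andP => -[/orP[]/eqP-> zB].
    by case/negP: xM; apply/bigcupP; exists B.
  by case/negP: yM; apply/bigcupP; exists B.
split; last first.
  rewrite cardsU1; case: (boolP (_ \in M)) => // BM.
  by case/negP: xM; apply/bigcupP; exists [set x; y] => //; rewrite set21.
apply/andP; split.
  rewrite subUset ME andbT sub1set; apply/edgeP; by exists x, y.
apply/trivIsetP => B B'; rewrite !inE.
case/predU1P=> [->|BM]; case/predU1P=> [->|BM'] neq.
- by rewrite eqxx in neq.
- exact: dis.
- by rewrite disjoint_sym dis.
- by move/trivIsetP: tM; apply.
Qed.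

Lemma matching_del M B :
  matching e M -> B \in M ->
  matching e (M :\ B) /\ {in B, forall x, x \notin cover (M :\ B)}.
Proof.
case/andP=> ME tM BM; split.
  rewrite /matching (subset_trans (subsetDl _ _) ME).
  by apply: trivIsetS tM; apply: subsetDl.
move=> x xB; apply/bigcupP => -[B' /setD1P[neq BM'] xB'].
by rewrite -(def_pblock tM BM xB) (def_pblock tM BM' xB') eqxx in neq.
Qed.

(** Along the augmenting path [x], [v], [w], [y], the edge [v]-[w] is exchanged for [v]-[x] and
    [w]-[y]. *)
Lemma matching_augment M v w x y :
  matching e M -> [set v; w] \in M -> e v w -> e v x -> e w y -> x != y ->
  x \notin cover M -> y \notin cover M -> #|M| < matching_number e.
Proof.
move=> mM BM evw evx ewy xy xM yM.
have [mN nN] := matching_del mM BM.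
have sub z : z \notin cover M -> z \notin cover (M :\ [set v; w]).
  apply: contra => /bigcupP[B /setD1P[_ B'M] zB]; apply/bigcupP; by exists B.
have inB z : z \in [set v; w] -> z \in cover M.
  by move=> zB; apply/bigcupP; exists [set v; w].
have [mP cP] := matching_add mN evx (nN _ (set21 _ _)) (sub _ xM).
have nP z : z \notin cover (M :\ [set v; w]) -> z != v -> z != x ->
    z \notin cover ([set v; x] |: M :\ [set v; w]).
  move=> zN zv zx; apply/bigcupP => -[B /setU1P[->|BN] zB].
    by move: zB; rewrite !inE (negPf zv) (negPf zx).
  by case/negP: zN; apply/bigcupP; exists B.
have [||mQ cQ] := matching_add mP ewy.
- apply: nP; first by rewrite nN ?set22.
    by rewrite eq_sym edge_neq.
  by apply: contraNneq xM => <-; rewrite inB ?set22.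
- apply: nP; first exact: sub.
    by apply: contraNneq yM => ->; rewrite inB ?set21.
  by rewrite eq_sym.
rewrite (cardsD1 [set v; w]) BM add1n -cP -cQ.
exact: matching_number_ge.
Qed.

Lemma cover_le_induced_matching A M :
  independent e A -> independent e (~: A) -> induced_matching e M ->
  #|M| = matching_number e -> cover_number e <= #|M|.
Proof.
move=> iA iA' iM maxM; have /andP[mM _] := iM; have /andP[ME tM] := mM.
pose outer v := [exists u, e v u && (u \notin cover M)].
(* The side [A] serves only as a tie-break, for edges of [M] with no outer endpoint. *)
pose D := [set v in cover M |
  outer v || (v \in A) && [forall w in pblock M v, ~~ outer w]].
have block v w : v \in cover M -> w \in cover M ->
    pblock M v = pblock M w -> v != w -> e v w /\ [set v; w] \in M.
  move=> vM wM eqB neq; have BE := subsetP ME _ (pblock_mem vM).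
  have vB : v \in pblock M v by rewrite mem_pblock.
  have wB : w \in pblock M v by rewrite eqB mem_pblock.
  have [evw <-] := edge_pair BE vB wB neq.
  by split; last exact: pblock_mem.
have outer_uniq v w : e v w -> [set v; w] \in M -> outer v -> outer w -> False.
  move=> evw BM /existsP[x /andP[evx xM]] /existsP[y /andP[ewy yM]].
  suff xy : x != y.
    by have := matching_augment mM BM evw evx ewy xy xM yM; rewrite maxM ltnn.
  (* A common unmatched neighbour would close a triangle with [v] and [w]. *)
  apply/eqP => xy; rewrite -{}xy in ewy.
  have := bipartite_edge iA iA' evw.
  rewrite (bipartite_edge iA iA' evx) (bipartite_edge iA iA' ewy).
  by case: (x \in A).
(* [D] takes at most one endpoint per edge of [M]: two outer endpoints give an augmenting path, and
   two endpoints in [A] are not adjacent. *)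
have Dinj : {in D &, injective (pblock M)}.
  move=> v w; rewrite !inE => /andP[vM vD] /andP[wM wD] eqB.
  apply/eqP; apply: contraT => neq; have [evw BM] := block v w vM wM eqB neq.
  have vB : v \in pblock M w by rewrite -eqB mem_pblock.
  have wB : w \in pblock M v by rewrite eqB mem_pblock.
  case/orP: vD => [ov|/andP[vA /forall_inP nv]].
    case/orP: wD => [ow|/andP[_ /forall_inP nw]].
      by case: (outer_uniq v w).
    by have := nw v vB; rewrite ov.
  case/orP: wD => [ow|/andP[wA _]]; first by have := nv w wB; rewrite ow.
  by have := bipartite_edge iA iA' evw; rewrite vA wA.
have DM : #|D| <= #|M|.
  rewrite -(card_in_imset Dinj); apply/subset_leq_card/subsetP => B.
  by case/imsetP=> v; rewrite inE => /andP[vM _] ->; apply: pblock_mem.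
apply: leq_trans DM; apply/cover_number_le/vertex_coverP => x y exy.
have half u v : e u v -> u \in cover M -> v \notin cover M -> u \in D.
  move=> euv uM vM; rewrite inE uM; apply/orP; left.
  by apply/existsP; exists v; rewrite euv.
(* An edge with both ends matched belongs to [M], as [M] is induced; with one end matched, that end
   is outer; with none, it could be added to [M]. *)
have [xM|xM] := boolP (x \in cover M); have [yM|yM] := boolP (y \in cover M).
- have eqB := induced_matching_block iM xM yM exy.
  have [_ BM] := block x y xM yM eqB (edge_neq exy).
  have defB : pblock M x = [set x; y] by apply: def_pblock BM _; rewrite ?set21.
  rewrite !inE xM yM -eqB defB /=.
  have [//|nx] := boolP (outer x); have [|ny] := boolP (outer y).
    by rewrite orbT.
  have -> : [forall w in [set x; y], ~~ outer w].
    by apply/forall_inP => w; rewrite !inE => /orP[]/eqP->.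
  by rewrite (bipartite_edge iA iA' exy) !andbT; case: (y \in A).
- by rewrite (half x y).
- by rewrite (half y x) ?orbT // e_sym.
- have [mN cN] := matching_add mM exy xM yM.
  by have := matching_number_ge mN; rewrite cN maxM ltnn.
Qed.

Lemma cameron_walker_full_num_mis :
  bipartite e -> cameron_walker e -> num_mis e = 2 ^ cover_number e.
Proof.
move=> [A [iA iA']] cw; have [M iM cM] := induced_matching_exists.
have [C cC eqC] := min_cover_exists.
apply/eqP; rewrite eqn_leq -{1}eqC num_mis_le //=.
apply: leq_trans (num_mis_ge iA iA' iM); rewrite leq_exp2l //.
by apply: cover_le_induced_matching iA iA' iM _; rewrite cM cw.
Qed.

End Graph.

Theorem theorem3p3 (T : finType) (e : rel T)
    (e_sym : symmetric e) (e_irr : irreflexive e) :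
  num_mis e = 2 ^ cover_number e <-> bipartite e /\ cameron_walker e.
Proof.
split; first exact: full_num_mis_cameron_walker.
by case; apply: cameron_walker_full_num_mis.
Qed.
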